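(* Consider the system of birational functional equations $$y(w+1)=F_1(y(w)),\qquad y:\mathbb{C}\to\mathbb{C}^N,\quad w\in\mathbb{C},$$ where $F_1$ is a birational map of $\mathbb{C}^N$ of degree $n=1$, given in homogeneous coordinates by $\phi(z)=Az$ with $A$ a complex $(N+1)\times(N+1)$ matrix, $\det A\neq 0$. This system has a general solution depending rationally on $w$ and linear-fractionally on $N$ arbitrary periodic functions $I_j(w)$, $j=1,\dots,N$, of $w$. Assume that $A$ has been preliminarily reduced to Jordan normal form: $$D=UAU^{-1},\qquad D=\mathrm{diag}(D^{(1)},\dots,D^{(r)}),\quad r\ge 1,\quad \dim D^{(i)}=k_i,$$ $$D^{(i)}_{s,t}=\lambda_i\delta_{s,t}+\delta_{s,t-1},\quad s,t\in\{1,\dots,k_i\},\qquad \sum_{i=1}^{r}k_i=N+1 .$$ Then this solution has the form $$y_i(w)=\frac{\sum_{l=1}^{N+1}(U^{-1})_{i,l}\,Y_l(w)}{\sum_{l=1}^{N+1}(U^{-1})_{N+1,l}\,Y_l(w)},\qquad i=1,\dots,N,$$ $$Y(w)=\{Y^{(1)}_1(w),\dots,Y^{(1)}_{k_1}(w),\dots,Y^{(r)}_1(w),\dots,Y^{(r)}_{k_r}(w)\},$$ $$Y^{(i)}_l(w)=\Big(\frac{\lambda_i}{\lambda_r}\Big)^{w}\sum_{m=1}^{k_i}C^{(i)}_{l,m}(w)\,I^{(i)}_m(w),$$ where $$I^{(i)}_l(w+1)=I^{(i)}_l(w),\qquad l=1,\dots,k_i,$$ $$C^{(i)}_{l,m}(w)=\frac{\Gamma(w+1)\,\lambda_i^{-(m-l)}}{\Gamma(w+1-m+l)\,\Gamma(m-l+1)},\qquad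 C^{(i)}_{m,m}\equiv 1,\qquad C^{(i)}_{l,m}\equiv 0\ \text{ for } l>m .$$ Here the functions $Y^{(r)}_{k_r}(w)$ and $I^{(r)}_{k_r}(w)$ are identically equal to $1$.
   Context: A birational map $F_n$ of $\mathbb{C}^N$ is written $y\mapsto y'$ with $y'_i=f_i(y)/f_{N+1}(y)$, $i=1,\dots,N$, where $f_1,\dots,f_{N+1}$ are polynomials with complex coefficients, and its degree is $n=\max_{1\le i\le N+1}\deg f_i$. In homogeneous coordinates $z=(z_1:\dots:z_{N+1})$ on $\mathbb{CP}^N$, with $y_i=z_i/z_{N+1}$, it becomes $z\mapsto z'=(\phi_1(z):\dots:\phi_{N+1}(z))$, where $\phi_i(z)=z_{N+1}^{\,n}f_i(z_1/z_{N+1},\dots,z_N/z_{N+1})$ are homogeneous polynomials without common factors. For $n=1$ the vector $\phi(z)=Az$ is linear, so $F_1$ is the linear-fractional map $F_1(y)_i=\big(\sum_{j=1}^{N}A_{i,j}y_j+A_{i,N+1}\big)/\big(\sum_{j=1}^{N}A_{N+1,j}y_j+A_{N+1,N+1}\big)$. The $N$ arbitrary periodic functions $I_j$ are the functions $I^{(i)}_m$ ($1\le i\le r$, $1\le m\le k_i$) other than $I^{(r)}_{k_r}$; periodic means of period $1$. $Y_l$, $l=1,\dots,N+1$, denotes the $l$-th entry of $Y$. $\delta$ is the Kronecker delta and $\Gamma$ the Gamma function.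
   Formalization: ''Depending rationally on w'' is proved as rational in w and the powers (λ_i/λ_r)^w (A=diag(2,1) gives y=2^w I, not rational); ''general'' means every solution where its Jordan coordinate Y^{(r)}_{k_r} is nonzero, as the formula sets it to 1. *)

(* Defs.v *)
(* MathComp and MathComp-Analysis; complex numbers are R[i] for R : realType. *)
From HB Require Import structures.
From mathcomp Require Export all_boot all_order all_algebra.
From mathcomp Require Export complex.
From mathcomp Require Export all_classical all_reals all_analysis.

Set Implicit Arguments.
Unset Strict Implicit.
Unset Printing Implicit Defensive.

Export Order.TTheory GRing.Theory Num.Theory numFieldNormedType.Exports.

Local Open Scope classical_set_scope.
Local Open Scope ring_scope.
Local Open Scope complex_scope.

Section ComplexFunctions.
Variable R : realType.
Implicit Types z w a : R[i].

Definition cexp z : R[i] :=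
  (expR (complex.Re z) * cos (complex.Im z))
    +i* (expR (complex.Re z) * sin (complex.Im z)).

(* Principal argument, with values in ]-pi, pi]. *)
Definition carg z : R :=
  let t := acos (complex.Re z / ComplexField.Normc.normc z) in
  if 0 <= complex.Im z then t else - t.

Definition clog z : R[i] := ln (ComplexField.Normc.normc z) +i* carg z.

(* Principal value of a ^ w, meaningful for a != 0; it satisfies 1 ^ w = 1. *)
Definition cpow a w : R[i] := cexp (w * clog a).

(* Gauss's product formula. At the poles 0, -1, -2, ... the convention
   0^-1 = 0 makes the value 0. *)
Definition Gamma z : R[i] :=
  lim ((fun n : nat =>
    (n`!%:R * cpow n%:R z / \prod_(0 <= j < n.+1) (z + j%:R)) : R[i]^o) @ \oo).

(* The coefficient C_{l,m}(w) attached to an eigenvalue lam. For l <= m the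
   quotient of Gamma functions has removable singularities where w + 1 is a
   pole of Gamma; the limit over the punctured neighbourhood of w removes
   them. *)
Definition coefC (lam : R[i]) (l m : nat) w : R[i] :=
  if (m < l)%N then 0 else
  lim ((fun v : R[i]^o =>
     (Gamma (v + 1) * lam ^- (m - l)
      / (Gamma (v + 1 - m%:R + l%:R) * Gamma ((m - l)%:R + 1))) : R[i]^o)
    @ (w : R[i]^o)^').

End ComplexFunctions.

Section LinearFractional.
Variable R : realType.
Variable N : nat.
Implicit Types (A : 'M[R[i]]_N.+1) (y : 'cV[R[i]]_N) (z : 'cV[R[i]]_N.+1).

(* The embedding of {1..N} into {1..N+1}; the index N+1 is ord_max. *)
Definition emb (i : 'I_N) : 'I_N.+1 := widen_ord (leqnSn N) i.

Definition affine_form A (i : 'I_N.+1) y : R[i] :=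
  \sum_(j < N) A i (emb j) * y j 0 + A i ord_max.

Definition F1 A y : 'cV[R[i]]_N :=
  \col_(i < N) (affine_form A (emb i) y / affine_form A ord_max y).

Definition F1_defined A y : Prop := affine_form A ord_max y != 0.

Definition is_solution A (y : R[i] -> 'cV[R[i]]_N) : Prop :=
  forall w, F1_defined A (y w) /\ y (w + 1) = F1 A (y w).

(* The system in homogeneous coordinates, for functions with values in CP^N
   given by nonzero representatives. The finite values of such a solution are
   those where z_{N+1} != 0; its other values are the poles of y. *)
Definition is_proj_solution A (z : R[i] -> 'cV[R[i]]_N.+1) : Prop :=
  (forall w, z w != 0) /\
  (forall w, exists2 c : R[i], c != 0 & z (w + 1) = c *: (A *m z w)).

End LinearFractional.

Section GeneralSolution.
Variable R : realType.

Definition jordan_block (n : nat) (lam : R[i]) : 'M[R[i]]_n :=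
  \matrix_(s < n, t < n) (lam *+ (s == t) + (s.+1 == t)%:R).

Variables (N r : nat) (k : 'I_r.+1 -> nat).
Hypothesis hk : (\sum_(i < r.+1) k i)%N = N.+1.

Definition jordan_mx (lam : 'I_r.+1 -> R[i]) : 'M[R[i]]_N.+1 :=
  castmx (hk, hk) (\mxdiag_(i < r.+1) jordan_block (k i) (lam i)).

(* The periodic functions I^{(i)}_m; the blocks are numbered by 'I_r.+1, so
   that the last block, called r in the usual numbering, is ord_max. *)
Definition coef_family : Type := forall i : 'I_r.+1, 'I_(k i) -> R[i] -> R[i].

Definition admissible (I : coef_family) : Prop :=
  (forall i l w, I i l (w + 1) = I i l w) /\
  (forall m : 'I_(k ord_max), m.+1 = k ord_max -> forall w, I ord_max m w = 1).

Variables (lam : 'I_r.+1 -> R[i]) (I : coef_family).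

Definition Yblock (i : 'I_r.+1) (l : 'I_(k i)) (w : R[i]) : R[i] :=
  cpow (lam i / lam ord_max) w * \sum_(m < k i) coefC (lam i) l m w * I m w.

Definition Yvec (w : R[i]) : 'cV[R[i]]_N.+1 :=
  castmx (hk, erefl 1%N) (\mxcol_(i < r.+1) \col_(l < k i) Yblock l w).

Variable U : 'M[R[i]]_N.+1.

Definition ysum (i : 'I_N.+1) (w : R[i]) : R[i] :=
  \sum_(l < N.+1) invmx U i l * Yvec w l 0.

Definition ygen (w : R[i]) : 'cV[R[i]]_N :=
  \col_(i < N) (ysum (emb i) w / ysum ord_max w).

End GeneralSolution.

(* Main.v *)
(* In homogeneous coordinates the system reads z(w+1) ~ A z(w). In the Jordan
   basis, normalized by the last coordinate, it splits into the linear systems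
   Y(w+1) = lam_r^-1 D^(i) Y(w), one for each block. Off the poles, the
   functional equation of Gamma turns C_{l,m}(w) into the polynomial
   binom(w, m-l) lam_i^-(m-l), so Pascal's rule says that the matrix
   M_i(w) = (lam_i/lam_r)^w C(w) satisfies M_i(w+1) = lam_r^-1 D^(i) M_i(w).
   As M_i(w) is triangular and invertible, Y solves the system exactly when
   M_i(w)^-1 Y^(i)(w) is periodic.

   Convergence of Gauss's product to a nonzero limit comes from the fact that
   the ratio of consecutive terms is 1 + O(1/n^2). *)
Require Import Defs.
From mathcomp Require Import ring lra.

Set Implicit Arguments.
Unset Strict Implicit.
Unset Printing Implicit Defensive.

Local Open Scope classical_set_scope.
Local Open Scope ring_scope.

(** * Elementary estimates *)

Section RealBounds.
Variable R : realType.
Implicit Types x y : R.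

(** The mean value theorem for [g - f] on [[0, x]]. *)
Lemma le_of_derive_le (f g df dg : R -> R) x : 0 <= x -> f 0 <= g 0 ->
  (forall t : R, is_derive t 1 f (df t)) ->
  (forall t : R, is_derive t 1 g (dg t)) ->
  (forall t : R, 0 <= t -> df t <= dg t) -> f x <= g x.
Proof.
move=> x0 fg0 dF dG le_d; rewrite -subr_ge0.
have dH (t : R) : is_derive t 1 (g - f) (dg t - df t) by exact: is_deriveB.
have cH : {within `[0, x], continuous (g - f)}.
  apply: continuous_subspaceT => t; apply: differentiable_continuous.
  by apply/derivable1_diffP; have [] := dH t.
have [c] := MVT_segment x0 (fun t _ => dH t) cH.
rewrite in_itv/= => /andP[c0 _] /eqP.
rewrite subr_eq subr0 !fctE => /eqP ->.
by rewrite addr_ge0 ?subr_ge0// mulr_ge0// subr_ge0 le_d.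
Qed.

Lemma sin_le_id x : 0 <= x -> sin x <= x.
Proof.
move=> x0; refine (@le_of_derive_le (@sin R) id (@cos R) (fun=> 1) x x0 _ _ _ _).
- by rewrite sin0.
- by move=> t _; exact: cos_le1.
Qed.

Lemma norm_sin_le x : `|sin x| <= `|x|.
Proof.
wlog x0 : x / 0 <= x => [hw|].
  have [/hw//|/ltW x0] := leP 0 x.
  by have := hw (- x); rewrite sinN !normrN; apply; rewrite oppr_ge0.
rewrite (ger0_norm x0) ler_norml sin_le_id// andbT.
suff : - sin x <= x by rewrite lerNl.
refine (@le_of_derive_le (- sin) id (fun t => - cos t) (fun=> 1) x x0 _ _ _ _).
- by rewrite fctE sin0 oppr0.
- by move=> t _; rewrite lerNl cos_geN1.
Qed.

(** Half-angle formula [1 - cos x = 2 sin^2 (x / 2)], with [|sin t| <= |t|]. *)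
Lemma cosB1_bound x : 0 <= 1 - cos x <= x ^+ 2.
Proof.
have -> : 1 - cos x = sin (x / 2) ^+ 2 *+ 2.
  have e : x = (x / 2) *+ 2 by field.
  by rewrite [in LHS]e cos_mulr2n cos2sin2; ring.
have h : sin (x / 2) ^+ 2 <= (x / 2) ^+ 2.
  by rewrite -[leLHS]real_normK ?num_real// -[leRHS]real_normK ?num_real//
    lerXn2r ?nnegrE// norm_sin_le.
have := sqr_ge0 (sin (x / 2)); have := sqr_ge0 x.
have : (x / 2) ^+ 2 = x ^+ 2 / 4 by field.
by lra.
Qed.

Lemma norm_sinB_le x : `|sin x - x| <= x ^+ 2.
Proof.
wlog x0 : x / 0 <= x => [hw|].
  have [/hw//|/ltW x0] := leP 0 x.
  have := hw (- x); rewrite sinN sqrrN -opprD normrN; apply.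
  by rewrite oppr_ge0.
rewrite ler_norml; apply/andP; split; last first.
  by have := sin_le_id x0; have := sqr_ge0 x; lra.
suff : x - x ^+ 2 <= sin x by lra.
refine (@le_of_derive_le (fun t => t - t ^+ 2) sin (fun t => 1 - 2 * t) cos
  x x0 _ _ _ _).
- by rewrite sin0 expr0n/= subrr.
- by move=> t; apply: is_derive_eq; rewrite -[t%:A]/(t * 1); ring.
(* The derivative bound [1 - 2 t <= cos t] follows from [1 - cos t <= t^2 <= 2 t] when [t <= 2], and
   from [cos t >= -1] beyond. *)
- move=> t t0; have /andP[_ ct] := cosB1_bound t.
  have [t2|t2] := leP t 2; last by have := cos_geN1 t; lra.
  suff : t ^+ 2 <= 2 * t by lra.
  by rewrite expr2 ler_wpM2r.
Qed.

Lemma expR_bounds x : `|x| <= 2^-1 ->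
  [/\ 0 <= expR x - 1 - x <= 2 * x ^+ 2, expR x <= 2 & `|expR x - 1| <= 2 * `|x| ].
Proof.
move=> x2; have /andP[xl xr] : - 2^-1 <= x <= 2^-1 by rewrite -ler_norml.
have lb := expR_ge1Dx x.
(* Multiplying [1 - x <= expR (- x)] by [expR x] turns the lower bound on the exponential into the
   upper bounds needed. *)
have hN : expR x * (1 - x) <= 1.
  by rewrite -[leRHS](expRxMexpNx_1 x) ler_pM2l ?expR_gt0// expR_ge1Dx.
have e2 : expR x <= 2.
  suff : expR x * 2^-1 <= 1 by lra.
  by apply: le_trans hN; rewrite ler_pM2l ?expR_gt0//; lra.
have e0 := expR_gt0 x.
have hx : expR x - 1 <= expR x * x by lra.
have hx2 : expR x - 1 - x <= 2 * x ^+ 2.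
  have : (expR x - 1 - x) * (1 - x) <= x ^+ 2 by rewrite expr2; lra.
  suff : (expR x - 1 - x) / 2 <= (expR x - 1 - x) * (1 - x) by lra.
  by rewrite ler_wpM2l; lra.
split=> //; first by apply/andP; split; lra.
have [x0|x0] := leP 0 x.
  rewrite (ger0_norm x0) ger0_norm; last lra.
  by apply: le_trans hx _; rewrite ler_wpM2r.
by rewrite (ltr0_norm x0) ler0_norm ?subr_le0 ?expR_le1 ?(ltW x0)//; lra.
Qed.

(** Both bounds are [ln (1 + x) <= x]: at [x = 1 / n], and, after inverting the ratio, at
    [x = - 1 / (n + 1)]. *)
Lemma ln_ratio_bounds n : (0 < n)%N ->
  n.+1%:R^-1 <= ln (n.+1%:R : R) - ln n%:R <= n%:R^-1.
Proof.
move=> n0; have n0' : 0 < n%:R :> R by rewrite ltr0n.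
have n1' : 0 < n.+1%:R :> R by [].
rewrite -ln_div ?posrE//; apply/andP; split.
  rewrite -lerN2 -lnV ?posrE ?divr_gt0// invf_div.
  have -> : n%:R / n.+1%:R = 1 + - n.+1%:R^-1 :> R.
    by rewrite -natr1; field; rewrite natr1.
  by apply: le_ln1Dx; rewrite ltrN2 invf_lt1// ltr1n.
have -> : n.+1%:R / n%:R = 1 + n%:R^-1 :> R.
  by rewrite -natr1; field; rewrite gt_eqF.
by apply: le_ln1Dx; apply: lt_trans (_ : 0 < _); rewrite ?ltrN10// invr_gt0.
Qed.

End RealBounds.

(** * Convergence of complex products *)

Section ComplexLimits.
Local Open Scope complex_scope.
Import ComplexField.Normc.
Variable R : realType.
Implicit Types (z u : R[i]) (P : nat -> R[i]).

Lemma norm_normc z : `|z| = (normc z)%:C.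
Proof. by case: z. Qed.

Lemma normc_ge0 z : 0 <= normc z.
Proof. by rewrite -ler0c -norm_normc. Qed.

Lemma normc_real (x : R) : normc x%:C = `|x|.
Proof. by rewrite /= expr0n/= addr0 sqrtr_sqr. Qed.

Lemma normc_le_ReIm z : normc z <= `|complex.Re z| + `|complex.Im z|.
Proof.
case: z => x y /=; rewrite -(ler_pXn2r (_ : 0 < 2)%N) ?nnegrE ?sqrtr_ge0//.
  by rewrite sqr_sqrtr ?addr_ge0 ?sqr_ge0// sqrrD !real_normK ?num_real//;
    rewrite addrAC lerDl mulrn_wge0// mulr_ge0.
Qed.

Lemma ReIm_le_normc z : `|complex.Re z| <= normc z /\ `|complex.Im z| <= normc z.
Proof.
case: z => x y /=; split.
  by rewrite -sqrtr_sqr ler_wsqrtr// lerDl sqr_ge0.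
by rewrite -sqrtr_sqr ler_wsqrtr// lerDr sqr_ge0.
Qed.

Lemma normc_sqr z : normc z ^+ 2 = complex.Re z ^+ 2 + complex.Im z ^+ 2.
Proof. by case: z => x y /=; rewrite sqr_sqrtr// addr_ge0 ?sqr_ge0. Qed.

Lemma cvg_complex (T : Type) (F : set_system T) (FF : Filter F)
    (f : T -> R[i]) (l : R[i]) :
  complex.Re (f x) @[x --> F] --> complex.Re l ->
  complex.Im (f x) @[x --> F] --> complex.Im l ->
  (f x : R[i]^o) @[x --> F] --> (l : R[i]^o).
Proof.
move=> /cvgrPdist_lt hRe /cvgrPdist_lt hIm; apply/cvgrPdist_lt => e e0.
(* In the order of [R[i]], a positive element is real. *)
have eE : e = (complex.Re e)%:C by rewrite RRe_real ?gtr0_real.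
have e2 : 0 < complex.Re e / 2 by rewrite divr_gt0// -ltcR -eE.
near=> x; rewrite norm_normc eE ltcR.
apply: le_lt_trans (normc_le_ReIm _) _.
rewrite [ltRHS](splitr (complex.Re e)) !raddfB/=.
by apply: ltrD; near: x; [exact: hRe|exact: hIm].
Unshelve. all: by end_near. Qed.

Lemma cvg_real_complex (T : Type) (F : set_system T) (FF : Filter F)
    (f : T -> R) (l : R) :
  f x @[x --> F] --> l -> ((f x)%:C : R[i]^o) @[x --> F] --> (l%:C : R[i]^o).
Proof. by move=> h; apply: cvg_complex => //=; exact: cvg_cst. Qed.

End ComplexLimits.

(** * Sequences whose consecutive ratios tend to 1 summably fast *)

Section ProductConvergence.
Local Open Scope complex_scope.
Import ComplexField.Normc.
Variable R : realType.
Implicit Types (c M : R) (P : nat -> R[i]).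

(* The increments of [1 / n] serve as a summable majorant. *)
Lemma cvg_of_telescoping_bound (x : nat -> R) (M : R) (m : nat) : 0 <= M ->
  (forall n, `|x n.+1 - x n| <= M * ((n + m)%:R^-1 - (n + m).+1%:R^-1)) ->
  cvgn x.
Proof.
move=> M0 h.
(* [u] is nondecreasing, [v] is nonincreasing and [u <= v], so [u] converges; its difference from
   [x] tends to 0. *)
pose u n := x n - M * (n + m)%:R^-1.
pose v n := x n + M * (n + m)%:R^-1.
have u_incr : {homo u : n p / (n <= p)%N >-> n <= p}.
  apply/nondecreasing_seqP => n; move: (h n).
  rewrite ler_norml /u addSn.
  move: (n + m)%:R^-1 (n + m).+1%:R^-1 => p q /andP[].
  by lra.
have v_decr : {homo v : n p / (n <= p)%N >-> n >= p}.
  apply/nonincreasing_seqP => n; move: (h n).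
  rewrite ler_norml /v addSn.
  move: (n + m)%:R^-1 (n + m).+1%:R^-1 => p q /andP[].
  by lra.
have Mm0 n : 0 <= M * (n + m)%:R^-1 by rewrite mulr_ge0// invr_ge0.
have cu : cvgn u.
  apply: nondecreasing_is_cvgn => //; exists (v 0%N) => _ [n _ <-].
  by apply: le_trans (v_decr _ _ (leq0n n)); rewrite /u /v; have := Mm0 n; lra.
have -> : x = u \+ (fun n => M * (n + m)%:R^-1).
  by apply/funext => n; rewrite /= /u subrK.
apply: is_cvgD => //; apply: is_cvgMr.
apply/cvg_ex; exists 0; rewrite (cvg_shiftn m (fun n => n%:R^-1 : R)).
apply/gtr0_cvgV0; last exact: cvgr_idn.
by exists 1%N => // n /=; rewrite ltr0n.
Qed.

Lemma telescoping_ge0 (n m : nat) : (0 < m)%N ->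
  0 <= (n + m)%:R^-1 - (n + m).+1%:R^-1 :> R.
Proof.
move=> m0; rewrite subr_ge0 lef_pV2 ?posrE ?ltr0n ?addn_gt0 ?m0 ?orbT//.
by rewrite ler_nat.
Qed.

(** A discrete Gronwall inequality: by [1 + t <= expR t], the weighted sequence [b] is
    nonincreasing, and it dominates [a]. *)
Lemma bounded_of_ratio (a : nat -> R) c (m : nat) : 0 <= c ->
  (forall n, 0 <= a n) ->
  (forall n, a n.+1 <= a n * (1 + c * ((n + m)%:R^-1 - (n + m).+1%:R^-1))) ->
  exists K, forall n, a n <= K.
Proof.
move=> c0 a0 h.
pose b n := a n * expR (c * (n + m)%:R^-1).
have b_decr : {homo b : n p / (n <= p)%N >-> n >= p}.
  apply/nonincreasing_seqP => n; rewrite /b addSn.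
  apply: le_trans (_ : a n * expR (c * ((n + m)%:R^-1 - (n + m).+1%:R^-1)) *
      expR (c * (n + m).+1%:R^-1) <= _).
    rewrite ler_wpM2r ?expR_ge0//; apply: le_trans (h n) _.
    by rewrite ler_wpM2l// expR_ge1Dx.
  by rewrite -mulrA -expRD -mulrDr subrK.
exists (b 0%N) => n; apply: le_trans (b_decr _ _ (leq0n n)).
by rewrite /b ler_peMr// -expR0 ler_expR mulr_ge0// invr_ge0.
Qed.

(** The relative bound first keeps [P] bounded; the increments then have a telescoping majorant, so
    real and imaginary parts converge. *)
Lemma cvg_of_ratio P c (m : nat) : (0 < m)%N -> 0 <= c ->
  (forall n, normc (P n.+1 - P n) <=
     normc (P n) * (c * ((n + m)%:R^-1 - (n + m).+1%:R^-1))) ->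
  exists l : R[i], (P n : R[i]^o) @[n --> \oo] --> (l : R[i]^o).
Proof.
move=> m0 c0 h.
have [K hK] : exists K, forall n, normc (P n) <= K.
  apply: (bounded_of_ratio (m := m) c0) => n; first exact: normc_ge0.
  rewrite mulrDr mulr1 -[P n.+1](subrK (P n)) addrC.
  by apply: le_trans (le_normcD _ _) _; rewrite lerD2l.
have hM n : normc (P n.+1 - P n) <=
    (K * c) * ((n + m)%:R^-1 - (n + m).+1%:R^-1).
  apply: le_trans (h n) _; rewrite -mulrA ler_wpM2r//.
  by rewrite mulr_ge0// telescoping_ge0.
have Kc0 : 0 <= K * c by rewrite mulr_ge0// (le_trans _ (hK 0%N))// normc_ge0.
have cRe : cvgn (fun n => complex.Re (P n)).
  apply: (@cvg_of_telescoping_bound _ (K * c) m Kc0) => n.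
  rewrite -raddfB; apply: le_trans (hM n); exact: (ReIm_le_normc _).1.
have cIm : cvgn (fun n => complex.Im (P n)).
  apply: (@cvg_of_telescoping_bound _ (K * c) m Kc0) => n.
  rewrite -raddfB; apply: le_trans (hM n); exact: (ReIm_le_normc _).2.
exists (limn (fun n => complex.Re (P n)) +i* limn (fun n => complex.Im (P n))).
exact: cvg_complex.
Qed.

(** The ratios have modulus at least 1/2, so the inverses satisfy the same kind of estimate with
    [2 * c]. Hence [P] and its inverse both converge, and the product of their limits is 1. *)
Lemma cvg_neq0_of_ratio P c (m : nat) : (0 < m)%N -> 0 <= c ->
  (forall n, P n != 0) ->
  (forall n, normc (P n.+1 / P n - 1) <=
     c * ((n + m)%:R^-1 - (n + m).+1%:R^-1) <= 2^-1) ->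
  exists2 l : R[i], l != 0 & (P n : R[i]^o) @[n --> \oo] --> (l : R[i]^o).
Proof.
move=> m0 c0 P0 h.
have [l hl] : exists l : R[i], (P n : R[i]^o) @[n --> \oo] --> (l : R[i]^o).
  apply: (cvg_of_ratio m0 c0) => n; have /andP[+ _] := h n.
  have -> : P n.+1 - P n = P n * (P n.+1 / P n - 1).
    by rewrite mulrBr mulr1 mulrC divfK.
  by rewrite normcM; apply: ler_wpM2l; exact: normc_ge0.
have [l' hl'] : exists l : R[i], ((P n)^-1 : R[i]^o) @[n --> \oo] --> (l : R[i]^o).
  have c2 : 0 <= 2 * c by rewrite mulr_ge0.
  apply: (cvg_of_ratio m0 c2) => n; have /andP[h1 h2] := h n.
  have q0 : P n.+1 / P n != 0 by rewrite mulf_neq0 ?invr_eq0.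
  have -> : (P n.+1)^-1 - (P n)^-1 =
      (P n)^-1 * ((P n.+1 / P n)^-1 * (1 - P n.+1 / P n)).
    by field; rewrite !P0.
  rewrite normcM; apply: ler_wpM2l; first exact: normc_ge0.
  rewrite normcM normcV -[1 - _]opprB normcN -mulrA.
  apply: ler_pM; rewrite ?invr_ge0 ?normc_ge0//.
  suff : 2^-1 <= normc (P n.+1 / P n).
    move=> hq; rewrite -[leRHS]invrK lef_pV2 ?posrE//.
    by apply: lt_le_trans hq; rewrite invr_gt0.
  have := le_normcD (P n.+1 / P n) (1 - P n.+1 / P n).
  rewrite [_ + (1 - _)]addrC subrK normc1 -[1 - _]opprB normcN.
  by have := le_trans h1 h2; lra.
exists l => //.
apply/eqP => l0.
have hM : (P n * (P n)^-1 : R[i]^o) @[n --> \oo] --> (l * l' : R[i]^o).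
  exact: cvgM hl hl'.
have h1 : (P n * (P n)^-1 : R[i]^o) @[n --> \oo] --> (1 : R[i]^o).
  rewrite (_ : (fun n => _) = cst 1); first exact: cvg_cst.
  by apply/funext => n; rewrite mulfV.
have : l * l' = 1 by apply: (norm_cvg_unique (V := R[i]^o)) hM h1.
by rewrite l0 mul0r => /esym/eqP; rewrite oner_eq0.
Qed.

End ProductConvergence.

(** * Complex powers and the Gamma function *)

Section ComplexPower.
Local Open Scope complex_scope.
Import ComplexField.Normc.
Variable R : realType.
Implicit Types (z u w a : R[i]).

Lemma cexpD z u : cexp (z + u) = cexp z * cexp u.
Proof.
case: z u => x y [x' y']; rewrite /cexp /= expRD sinD cosD.
by simpc; congr (_ +i* _); ring.
Qed.

Lemma cexp0 : cexp (0 : R[i]) = 1.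
Proof. by rewrite /cexp/= expR0 cos0 sin0 mulr0 mulr1. Qed.

Lemma cexp_neq0 z : cexp z != 0.
Proof.
apply/eqP => z0; have /eqP := cexpD z (- z).
by rewrite subrr cexp0 z0 mul0r oner_eq0.
Qed.

(** Since [sin (acos t) = sqrt (1 - t^2)], the polar form recovers [Im a] up to sign; the case split
    in [carg] restores the sign. *)
Lemma clogK a : a != 0 -> cexp (clog a) = a.
Proof.
move=> a0.
have n0 : 0 < normc a by rewrite -ltcR -norm_normc normr_gt0.
have t1 : -1 <= complex.Re a / normc a <= 1.
  rewrite -ler_norml normrM normfV (gtr0_norm n0) ler_pdivrMr// mul1r.
  exact: (ReIm_le_normc a).1.
have sinE : normc a * sin (acos (complex.Re a / normc a)) = `|complex.Im a|.
  rewrite sin_acos// -[X in X * _](gtr0_norm n0) -sqrtr_sqr -sqrtrM ?sqr_ge0//.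
  rewrite -[RHS]sqrtr_sqr; congr Num.sqrt.
  rewrite mulrBr mulr1 -exprMn [normc a * _]mulrC divfK ?gt_eqF// normc_sqr.
  by rewrite [_ + complex.Im a ^+ 2]addrC addrK.
rewrite /cexp /clog /carg /= lnK ?posrE//.
case: a a0 n0 t1 sinE => x y a0 n0 t1.
rewrite [complex.Re _]/= [complex.Im _]/= in t1 *.
case: ifPn => y0 sinE; congr (_ +i* _).
- by rewrite acosK ?in_itv//= mulrC divfK// gt_eqF.
- by rewrite sinE ger0_norm.
- by rewrite cosN acosK ?in_itv//= mulrC divfK// gt_eqF.
- by rewrite sinN mulrN sinE ltr0_norm ?opprK// ltNge.
Qed.

Lemma clog_nat n : (0 < n)%N -> clog (n%:R : R[i]) = (ln n%:R)%:C.
Proof.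
move=> n0.
have -> : n%:R = (n%:R)%:C :> R[i] by rewrite rmorph_nat.
rewrite /clog /carg normc_real [complex.Re _]/= [complex.Im _]/= lexx.
by rewrite ger0_norm ?ler0n// divff ?pnatr_eq0 -?lt0n// acos1.
Qed.

Lemma cpowD1 a w : a != 0 -> cpow a (w + 1) = a * cpow a w.
Proof. by move=> a0; rewrite /cpow mulrDl mul1r cexpD clogK// mulrC. Qed.

Lemma cpow_neq0 a w : cpow a w != 0.
Proof. exact: cexp_neq0. Qed.

Lemma cpow1 w : cpow 1 w = 1.
Proof. by rewrite /cpow -[1]/(1%:R) clog_nat// ln1 mulr0 cexp0. Qed.

Lemma cpow_nat_ratio n z : (0 < n)%N ->
  cpow n.+1%:R z / cpow n%:R z = cexp (z * (ln n.+1%:R - ln n%:R)%:C).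
Proof.
move=> n0; apply: (canLR (mulfK (cpow_neq0 _ _))).
by rewrite /cpow !clog_nat// -cexpD -mulrDr -rmorphD subrK.
Qed.

(** A Taylor estimate of second order, obtained from the real bounds on [expR], [sin] and [cos]; the
    constant is generous. *)
Lemma normc_cexpB_le z : normc z <= 2^-1 ->
  normc (cexp z - 1 - z) <= 10 * normc z ^+ 2.
Proof.
move=> z2; apply: le_trans (normc_le_ReIm _) _; rewrite normc_sqr.
have [xz yz] := ReIm_le_normc z.
case: z z2 xz yz => x y z2; rewrite [complex.Re _]/= [complex.Im _]/= => xz yz.
have [/andP[e1 e2] e3 e4] := expR_bounds (le_trans xz z2).
have /andP[c1 c2] := cosB1_bound y.
have s1 := norm_sin_le y.
have s2 := norm_sinB_le y.
rewrite /cexp !raddfB/= subr0.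
have hRe : `|expR x * cos y - 1 - x| <= 2 * x ^+ 2 + 2 * y ^+ 2.
  have -> : expR x * cos y - 1 - x = (expR x - 1 - x) - expR x * (1 - cos y).
    by ring.
  apply: le_trans (ler_normB _ _) _; apply: lerD; first by rewrite ger0_norm.
  by rewrite ger0_norm ?mulr_ge0 ?expR_ge0// ler_pM// expR_ge0.
have hIm : `|expR x * sin y - y| <= 2 * `|x| * `|y| + y ^+ 2.
  have -> : expR x * sin y - y = (expR x - 1) * sin y + (sin y - y) by ring.
  apply: le_trans (ler_normD _ _) _; apply: lerD => //.
  by rewrite normrM ler_pM.
apply: le_trans (lerD hRe hIm) _.
(* By [2 |x| |y| <= x^2 + y^2], the two bounds add up to at most [3 x^2 + 4 y^2]. *)
have := sqr_ge0 (`|x| - `|y|).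
rewrite sqrrB !real_normK ?num_real// -mulr_natr.
have := sqr_ge0 x; have := sqr_ge0 y; lra.
Qed.

End ComplexPower.

(** * Gauss's product: convergence, poles and functional equation *)

Section GammaFunction.
Local Open Scope complex_scope.
Import ComplexField.Normc.
Variable R : realType.
Implicit Types (z w : R[i]).

Definition gauss z (n : nat) : R[i] :=
  n`!%:R * cpow n%:R z / \prod_(0 <= j < n.+1) (z + j%:R).

Lemma Gamma_lim z l : (gauss z n : R[i]^o) @[n --> \oo] --> (l : R[i]^o) ->
  Gamma z = l.
Proof. by move=> h; apply: cvg_lim h; exact: norm_hausdorff. Qed.

Lemma gauss_neq0 z n : (forall n : nat, z != - n%:R) -> gauss z n != 0.
Proof.
move=> z0; apply: mulf_neq0.
  by rewrite mulf_neq0 ?cpow_neq0// pnatr_eq0 -lt0n fact_gt0.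
rewrite invr_eq0 prodf_seq_neq0; apply/allP => j _ /=.
by rewrite addr_eq0.
Qed.

Lemma gauss_ratio z n : (0 < n)%N -> (forall n : nat, z != - n%:R) ->
  gauss z n.+1 / gauss z n =
    cexp (z * (ln n.+1%:R - ln n%:R)%:C) * (1 + z * n.+1%:R^-1)^-1.
Proof.
move=> n0 z0; rewrite -cpow_nat_ratio// /gauss factS big_nat_recr//= natrM.
have h1 := cpow_neq0 (n%:R : R[i]) z.
have h2 : \prod_(0 <= j < n.+1) (z + j%:R) != 0.
  by rewrite prodf_seq_neq0; apply/allP => j _ /=; rewrite addr_eq0.
have h3 : n`!%:R != 0 :> R[i] by rewrite pnatr_eq0 -lt0n fact_gt0.
have h4 : z + n.+1%:R != 0 by rewrite addr_eq0.
have h5 : n.+1%:R != 0 :> R[i] by rewrite pnatr_eq0.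
move: (\prod_(0 <= j < n.+1) (z + j%:R)) (cpow n%:R z) (cpow n.+1%:R z)
  (n`!%:R : R[i]) (n.+1%:R : R[i]) h2 h1 h3 h4 h5 => p c c' f m h1 h2 h3 h4 h5.
by field; rewrite ?h1 ?h2 ?h3 ?h4 ?h5 // addrC h4.
Qed.

(** With [t = ln (n + 1) - ln n], [p = 1 / n] and [q = 1 / (n + 1)], the ratio minus 1 is
    [(cexp (z t) - 1 - z q) / (1 + z q)]. Its numerator is a Taylor remainder plus [z (t - q)], and
    both are of order [p - q = p q]. *)
Lemma gauss_ratio_bound z : exists c, 0 <= c /\ exists m, (0 < m)%N /\
  forall n, (m <= n)%N -> (forall n : nat, z != - n%:R) ->
  normc (gauss z n.+1 / gauss z n - 1) <= c * (n%:R^-1 - n.+1%:R^-1) <= 2^-1.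
Proof.
set N := normc z; have N0 : 0 <= N by exact: normc_ge0.
(* The inner sum bounds the numerator: 20 is the Taylor constant 10 times the 2 of
   [t^2 <= p^2 <= 2 p q]. The outer 2 pays for a denominator of modulus at least 1/2. *)
pose c := 2 * (20 * N ^+ 2 + N).
have c0 : 0 <= c by rewrite /c; have := sqr_ge0 N; lra.
(* Beyond [b], both [c / n] and [N / n] are at most 1/2. *)
exists c; split => //; pose b := 2 * c + 2 * N + 1.
have b0 : 0 <= b by rewrite /b; lra.
have mb := archi_boundP b0.
exists (Num.bound b); split; first by rewrite -(ltr0n R); lra.
move=> n mn z0.
have nb : b < n%:R by apply: lt_le_trans mb _; rewrite ler_nat.
have n0 : (0 < n)%N by rewrite -(ltr0n R); lra.
have [t1 t2] := andP (ln_ratio_bounds R n0).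
rewrite gauss_ratio//; set t := ln _ - _ in t1 t2 *.
have hq : n.+1%:R^-1 = (n.+1%:R^-1)%:C :> R[i] by rewrite fmorphV rmorph_nat.
rewrite hq.
have pn : n%:R * n%:R^-1 = 1 :> R by rewrite divff ?pnatr_eq0 -?lt0n.
have qn : (n%:R + 1) * n.+1%:R^-1 = 1 :> R by rewrite natr1 divff ?pnatr_eq0.
have p0 : 0 < n%:R^-1 :> R by rewrite invr_gt0 ltr0n.
have q0 : 0 < n.+1%:R^-1 :> R by rewrite invr_gt0 ltr0n.
have n1 : 1 <= n%:R :> R by rewrite ler1n.
move: (n%:R : R) (n%:R^-1 : R) (n.+1%:R^-1 : R) nb t1 t2 pn qn p0 q0 n1.
move=> k p q nb t1 t2 kp kq p0 q0 k1; clear hq.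
have pq : p - q = p * q by nra.
have Np : N * p <= 2^-1 by rewrite /b in nb; nra.
have Nq : N * q <= 2^-1 by nra.
have cp : c * p <= 2^-1 by rewrite /b in nb; nra.
have t0 : 0 < t by lra.
have normD : 2^-1 <= normc (1 + z * q%:C).
  have := le_normcD (1 + z * q%:C) (- (z * q%:C)).
  rewrite addrK normc1 normcN normcM normc_real (gtr0_norm q0) -/N; lra.
have D0 : 1 + z * q%:C != 0.
  by apply: contraTneq normD => ->; rewrite normc0 -ltNge invr_gt0.
have num : normc (cexp (z * t%:C) - (1 + z * q%:C)) <= (20 * N ^+ 2 + N) * (p - q).
  have -> : cexp (z * t%:C) - (1 + z * q%:C) =
      (cexp (z * t%:C) - 1 - z * t%:C) + z * (t - q)%:C.
    have -> : (t - q)%:C = t%:C - q%:C :> R[i] by rewrite rmorphB.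
    by rewrite mulrBr; ring.
  apply: le_trans (le_normcD _ _) _; rewrite mulrDl; apply: lerD.
    have nu : normc (z * t%:C) = N * t by rewrite normcM normc_real gtr0_norm.
    apply: le_trans (normc_cexpB_le _) _; first by rewrite nu; nra.
    have tp : t ^+ 2 <= p ^+ 2 by rewrite lerXn2r ?nnegrE //; lra.
    have p2q : p <= 2 * q by nra.
    have tpq : t ^+ 2 <= 2 * (p - q) by rewrite pq; nra.
    have := ler_wpM2l (sqr_ge0 N) tpq; rewrite nu exprMn; lra.
  rewrite normcM normc_real -/N ger0_norm; last lra.
  by rewrite ler_wpM2l//; lra.
apply/andP; split; last by nra.
rewrite -[X in _ - X](divff D0) -mulrBl normcM normcV.
rewrite ler_pdivrMr ?(lt_le_trans _ normD) ?invr_gt0//.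
apply: le_trans num _; rewrite /c -[2 * _ * (p - q)]mulrA.
have : 0 <= (20 * N ^+ 2 + N) * (p - q).
  by rewrite mulr_ge0//; [have := sqr_ge0 N; lra|rewrite pq mulr_ge0 ?ltW].
move: ((20 * N ^+ 2 + N) * (p - q)) normD => e nD e0.
nra.
Qed.

Lemma Gamma_cvg z : (forall n : nat, z != - n%:R) ->
  Gamma z != 0 /\ (gauss z n : R[i]^o) @[n --> \oo] --> (Gamma z : R[i]^o).
Proof.
move=> z0; have [c [c0 [m [m0 h]]]] := gauss_ratio_bound z.
(* The ratio bound only holds from rank [m] on, hence the shifted sequence. *)
have [||l l0] := @cvg_neq0_of_ratio R (fun n => gauss z (n + m)) c m m0 c0.
- by move=> n; exact: gauss_neq0.
- by move=> n; rewrite addSn; apply: h => //; rewrite leq_addl.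
rewrite (cvg_shiftn m (gauss z : nat -> R[i]^o)) => hl.
by rewrite (Gamma_lim hl).
Qed.

(** From rank [n] on the denominator contains a zero factor, and [0^-1 = 0] makes the terms
    vanish. *)
Lemma Gamma_pole (n : nat) : Gamma (- n%:R : R[i]) = 0.
Proof.
apply: Gamma_lim.
apply: cvg_near_cst; near=> k.
have nk : (n < k.+1)%N by rewrite ltnS; near: k; exact: nbhs_infty_ge.
rewrite /gauss (_ : \prod_(0 <= j < k.+1) _ = 0) ?invr0 ?mulr0//.
apply/eqP; rewrite prodf_seq_eq0; apply/hasP; exists n.
  by rewrite mem_index_iota.
by rewrite /= addNr.
Unshelve. all: by end_near. Qed.

Lemma inv_nat_cvg0 : ((n%:R^-1 : R[i]^o)) @[n --> \oo] --> (0 : R[i]^o).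
Proof.
have : (n%:R^-1 : R) @[n --> \oo] --> (0 : R).
  apply/gtr0_cvgV0; last exact: cvgr_idn.
  by exists 1%N => // n /=; rewrite ltr0n.
move=> /cvg_real_complex; apply: cvg_trans; apply: near_eq_cvg.
by near=> n; rewrite fmorphV rmorph_nat.
Unshelve. all: by end_near. Qed.

Lemma cvg_nat_ratio1 (a : R[i]) :
  (n%:R / (n%:R + a) : R[i]^o) @[n --> \oo] --> (1 : R[i]^o).
Proof.
have h : ((1 + a * n%:R^-1)^-1 : R[i]^o) @[n --> \oo] --> (1 : R[i]^o).
  rewrite -[X in _ --> X]invr1; apply: cvgV; first exact: oner_neq0.
  rewrite -[X in _ --> X]addr0; apply: cvgD; first exact: cvg_cst.
  rewrite -[X in _ --> X](mulr0 a); apply: cvgM; first exact: cvg_cst.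
  exact: inv_nat_cvg0.
apply: cvg_trans h; apply: near_eq_cvg; near=> n.
have n0 : n%:R != 0 :> R[i].
  by rewrite pnatr_eq0 -lt0n; near: n; exact: nbhs_infty_gt.
by rewrite -[RHS]invf_div mulrDl divff.
Unshelve. all: by end_near. Qed.

(** The functional equation before the limit: it holds up to a factor that tends to 1. *)
Lemma gaussD1 z n : (0 < n)%N -> (forall n : nat, z != - n%:R) ->
  gauss (z + 1) n = z * gauss z n * (n%:R / (n%:R + (z + 1))).
Proof.
move=> n0 z0; rewrite /gauss.
have n0' : n%:R != 0 :> R[i] by rewrite pnatr_eq0 -lt0n.
rewrite cpowD1//.
have hz : z != 0 by have := z0 0%N; rewrite oppr0.
have hzn : n%:R + (z + 1) != 0.
  by rewrite addrC -addrA addr_eq0 nat1r.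
have h1 : \prod_(0 <= j < n.+1) (z + j%:R) != 0.
  by rewrite prodf_seq_neq0; apply/allP => j _ /=; rewrite addr_eq0.
(* Shifting [z] by 1 drops the first factor [z] and adds the factor [z + n + 1]. *)
have -> : \prod_(0 <= j < n.+1) (z + 1 + j%:R) =
    (\prod_(0 <= j < n.+1) (z + j%:R)) * (n%:R + (z + 1)) / z.
  apply: (canRL (mulfK hz)).
  transitivity (\prod_(0 <= j < n.+2) (z + j%:R)); last first.
    by rewrite big_nat_recr//= -nat1r; congr (_ * _); ring.
  rewrite [RHS]big_nat_recl//= addr0 mulrC; congr (_ * _).
  by apply: eq_bigr => j _; rewrite -addrA nat1r.
by field; rewrite ?h1 ?hz ?hzn.
Qed.

Lemma GammaD1 z : (forall n : nat, z != - n%:R) -> Gamma (z + 1) = z * Gamma z.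
Proof.
move=> z0; apply: Gamma_lim.
have -> : z * Gamma z = z * Gamma z * 1 by rewrite mulr1.
have : (z * gauss z n * (n%:R / (n%:R + (z + 1))) : R[i]^o) @[n --> \oo] -->
    (z * Gamma z * 1 : R[i]^o).
  apply: cvgM; last exact: cvg_nat_ratio1.
  by apply: cvgM; [exact: cvg_cst|exact: (Gamma_cvg z0).2].
apply: cvg_trans; apply: near_eq_cvg; near=> n.
by rewrite -gaussD1//; near: n; exact: nbhs_infty_gt.
Unshelve. all: by end_near. Qed.

Lemma natr_not_pole (d : nat) : forall n : nat, d.+1%:R != - n%:R :> R[i].
Proof. by move=> n; rewrite -addr_eq0 -natrD pnatr_eq0. Qed.

Lemma Gamma1 : Gamma (1 : R[i]) = 1.
Proof.
apply: Gamma_lim.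
have := @cvg_nat_ratio1 1; apply: cvg_trans; apply: near_eq_cvg; near=> n.
have n0 : (0 < n)%N by near: n; exact: nbhs_infty_gt.
rewrite /gauss (_ : cpow _ 1 = n%:R); last first.
  by rewrite /cpow mul1r clogK// pnatr_eq0 -lt0n.
have -> : \prod_(0 <= j < n.+1) (1 + j%:R) = n`!%:R * n.+1%:R :> R[i].
  rewrite -natrM mulnC -factS fact_prod natr_prod big_add1/=.
  by apply: eq_bigr => j _; rewrite nat1r.
have h3 : n`!%:R != 0 :> R[i] by rewrite pnatr_eq0 -lt0n fact_gt0.
rewrite natr1; apply/eqP; rewrite eqr_div ?mulf_neq0 ?pnatr_eq0//.
  by rewrite mulrCA mulrA [n`!%:R * _]mulrC.
by rewrite -lt0n fact_gt0.
Unshelve. all: by end_near. Qed.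

Lemma Gamma_fact (d : nat) : Gamma (d%:R + 1 : R[i]) = d`!%:R.
Proof.
elim: d => [|d IHd]; first by rewrite add0r Gamma1.
rewrite GammaD1; last exact: natr_not_pole.
by rewrite -natr1 IHd factS natrM natr1.
Qed.

Lemma Gamma_ratio (d : nat) z : (forall n : nat, z != - n%:R) ->
  Gamma (z + d%:R) = (\prod_(0 <= j < d) (z + j%:R)) * Gamma z.
Proof.
move=> z0; elim: d => [|d IHd]; first by rewrite big_geq// mul1r addr0.
rewrite -natr1 addrA GammaD1 ?IHd ?big_nat_recr//=; first by ring.
by move=> n; rewrite eq_sym -subr_eq eq_sym -opprD -natrD.
Qed.

End GammaFunction.

(** * The coefficients C *)

Section Coefficients.
Local Open Scope complex_scope.
Import ComplexField.Normc.
Variable R : realType.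
Implicit Types (w v lam : R[i]) (p : {poly R[i]}).

(** The generalized binomial coefficient [binom(w, d)] as a polynomial in [w], so that its
    continuity can fill the removable singularities of the Gamma quotient. *)
Definition binomial_poly (d : nat) : {poly R[i]} :=
  d`!%:R^-1 *: \prod_(0 <= j < d) ('X - j%:R%:P).

Lemma horner_binomial_poly d w :
  (binomial_poly d).[w] = (\prod_(0 <= j < d) (w - j%:R)) / d`!%:R.
Proof.
rewrite /binomial_poly hornerZ mulrC horner_prod; congr (_ / _).
by apply: eq_bigr => j _; rewrite hornerXsubC.
Qed.

Lemma binomial_poly0 : binomial_poly 0 = 1.
Proof. by rewrite /binomial_poly big_geq// invr1 scale1r. Qed.

Lemma binomial_poly_pascal d w :
  (binomial_poly d.+1).[w + 1] =
  (binomial_poly d.+1).[w] + (binomial_poly d).[w].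
Proof.
(* Removing the first factor on the left and the last one on the right leaves the same product of
   [d] factors. *)
rewrite !horner_binomial_poly [in LHS]big_nat_recl// [in RHS]big_nat_recr//=.
have -> : \prod_(0 <= j < d) (w + 1 - j.+1%:R) = \prod_(0 <= j < d) (w - j%:R).
  by apply: eq_bigr => j _; rewrite -natr1; ring.
rewrite subr0 factS natrM.
have h1 : d`!%:R != 0 :> R[i] by rewrite pnatr_eq0 -lt0n fact_gt0.
have h2 : d.+1%:R != 0 :> R[i] by rewrite pnatr_eq0.
move: h1 h2; rewrite -natr1; move: (\prod_(0 <= j < d) _) => q h1 h2.
by field; rewrite h1 h2.
Qed.

Lemma continuous_horner p : continuous (fun w : R[i]^o => p.[w] : R[i]^o).
Proof.
elim/poly_ind: p => [|p c IHp].
  have -> : (fun w : R[i]^o => (0 : {poly R[i]}).[w] : R[i]^o) = cst 0.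
    by apply/funext => w; rewrite horner0.
  exact: cst_continuous.
move=> w.
have hp : (p.[v] : R[i]^o) @[v --> (w : R[i]^o)] --> (p.[w] : R[i]^o).
  exact: IHp.
have hv : (v : R[i]^o) @[v --> (w : R[i]^o)] --> (w : R[i]^o).
  exact: cvg_id.
have hc : (c : R[i]^o) @[v --> (w : R[i]^o)] --> (c : R[i]^o).
  exact: (@cst_continuous R[i]^o R[i]^o).
have hM : (p.[v] * v : R[i]^o) @[v --> (w : R[i]^o)] --> (p.[w] * w : R[i]^o).
  exact: cvgM hp hv.
have pE : (fun v : R[i]^o => (p * 'X + c%:P).[v] : R[i]^o) =
    (fun v : R[i]^o => p.[v] * v + c : R[i]^o).
  by apply/funext => v; rewrite hornerMXaddC.
rewrite /continuous_at pE hornerMXaddC; exact: cvgD hM hc.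
Qed.

(** Needed to evaluate the punctured limit in [coefC]. Poles lie at mutual distance at least 1, so
    at most one is within 1/2 of [w + a]. *)
Lemma near_not_pole (w a : R[i]) :
  \forall v \near (w : R[i]^o)^', forall n : nat, v + a != - n%:R.
Proof.
have close (n m : nat) : `|w + a + n%:R| < 2^-1 -> `|w + a + m%:R| < 2^-1 -> n = m.
  wlog nm : n m / (n <= m)%N => [hw|hn hm].
    by have [/hw//|/ltnW/hw h hn hm] := leqP n m; apply/esym; exact: h.
  have : `|m%:R - n%:R| < 1 :> R[i].
    have -> : m%:R - n%:R = (w + a + m%:R) - (w + a + n%:R) by ring.
    apply: le_lt_trans (ler_normB _ _) _.
    by rewrite [ltRHS](splitr 1) ltrD ?mul1r.
  rewrite -natrB// normr_nat -[1]/(1%:R) ltr_nat ltnS leqn0 subn_eq0 => mn.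
  by apply/eqP; rewrite eqn_leq nm.
(* If a pole other than [w + a] itself is that close, its distance serves as the radius; otherwise
   1/2 does. *)
have [[m [wm0 wm]]|nw] :=
    pselect (exists m : nat, w + a + m%:R != 0 /\ `|w + a + m%:R| < 2^-1).
  apply/nbhs_ballP; exists `|w + a + m%:R|; first by rewrite /= normr_gt0.
  move=> v + vw n; rewrite -ball_normE /= => wv; apply/eqP => vn.
  have e : w - v = w + a + n%:R by rewrite -[n%:R]opprK -vn; ring.
  move: wv; rewrite e => wv.
  by move: (wv); rewrite (close _ _ (lt_trans wv wm) wm) ltxx.
apply/nbhs_ballP; exists 2^-1; first by rewrite /= invr_gt0.
move=> v + vw n; rewrite -ball_normE /= => wv; apply/eqP => vn.
have e : w - v = w + a + n%:R by rewrite -[n%:R]opprK -vn; ring.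
apply: nw; exists n; rewrite -e; split => //.
by rewrite subr_eq0 eq_sym.
Qed.

Lemma Gamma_quotient (d : nat) v : (forall n : nat, v + 1 - d%:R != - n%:R) ->
  Gamma (v + 1) / (Gamma (v + 1 - d%:R) * Gamma (d%:R + 1)) =
  (binomial_poly d).[v].
Proof.
move=> v0; have [G0 _] := Gamma_cvg v0.
rewrite -{1}(subrK d%:R (v + 1)) Gamma_ratio// Gamma_fact horner_binomial_poly.
rewrite invfM mulrA mulfK//; congr (_ / _).
rewrite big_nat_rev /= add0n !big_nat; apply: eq_bigr => j /andP[_ jd].
by rewrite natrB// -natr1; ring.
Qed.

(** Only [m - l] enters, so numbering the indices from 0 instead of 1 changes nothing. *)
Definition coef_poly lam (l m : nat) : {poly R[i]} :=
  if (m < l)%N then 0 else lam ^- (m - l) *: binomial_poly (m - l).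

(** Near [w], but away from [w], the Gamma quotient equals the polynomial, whose continuity gives
    the limit. *)
Lemma coefCE lam (l m : nat) w : coefC lam l m w = (coef_poly lam l m).[w].
Proof.
rewrite /coefC /coef_poly; case: ltnP => lm; first by rewrite horner0.
have p_cvg : ((lam ^- (m - l) *: binomial_poly (m - l)).[v] : R[i]^o)
    @[v --> (w : R[i]^o)^'] -->
    ((lam ^- (m - l) *: binomial_poly (m - l)).[w] : R[i]^o).
  by apply: cvg_within_filter; exact: continuous_horner.
apply: (cvg_lim (@norm_hausdorff _ R[i]^o)).
apply: cvg_trans p_cvg; apply: near_eq_cvg; near=> v.
rewrite hornerZ -Gamma_quotient.
  rewrite natrB// opprB addrA [v + 1 + _ - _]addrAC mulrCA mulrA.
  by [].
rewrite -[v + 1 - _]addrA; near: v; exact: near_not_pole.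
Unshelve. all: by end_near. Qed.

Lemma coefC_gt lam (l m : nat) w : (m < l)%N -> coefC lam l m w = 0.
Proof. by move=> ml; rewrite /coefC ml. Qed.

Lemma coefC_diag lam (m : nat) w : coefC lam m m w = 1.
Proof.
by rewrite coefCE /coef_poly ltnn subnn binomial_poly0 expr0 invr1 scale1r hornerE.
Qed.

(** Pascal's rule for [d = m - l]; row [l + 1] carries one inverse power of [lam] fewer, which
    absorbs the factor [lam]. *)
Lemma coefC_pascal lam (l m : nat) w : lam != 0 ->
  lam * coefC lam l m (w + 1) = lam * coefC lam l m w + coefC lam l.+1 m w.
Proof.
move=> lam0; rewrite !coefCE /coef_poly ltnS.
case: (ltngtP m l) => [ml|lm|->].
- by rewrite !horner0 mulr0 addr0.
- have [d dE] : exists d, (m - l)%N = d.+1.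
    by exists (m - l).-1; rewrite prednK ?subn_gt0.
  rewrite ![(_ *: binomial_poly _).[_]]hornerZ subnS dE binomial_poly_pascal /=.
  by rewrite exprS; field; rewrite lam0 expf_neq0.
- by rewrite subnn binomial_poly0 !hornerE.
Qed.

Lemma coefC_Gamma lam (l m : nat) w : (l <= m)%N ->
  (forall n : nat, w + 1 != - n%:R) ->
  coefC lam l m w = Gamma (w + 1) * lam ^- (m - l)
    / (Gamma (w + 1 - m%:R + l%:R) * Gamma ((m - l)%:R + 1)).
Proof.
move=> lm w0; rewrite coefCE /coef_poly ltnNge lm /= hornerZ.
have -> : w + 1 - m%:R + l%:R = w + 1 - (m - l)%:R by rewrite natrB//; ring.
move: (m - l)%N => d.
have [hd|] := pselect (forall n : nat, w + 1 - d%:R != - n%:R).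
  by rewrite -Gamma_quotient// mulrCA mulrA.
(* Here the first Gamma in the denominator is at a pole, so the right side is 0 by convention. Since
   [w + 1] is not a pole, [w = d - n - 1] is a natural number below [d], hence a root of the
   binomial polynomial. *)
move=> /existsNP[n /negP/negPn/eqP hn].
rewrite hn Gamma_pole mul0r invr0 mulr0 horner_binomial_poly.
have wE : w + 1 = d%:R - n%:R by rewrite -hn; ring.
have nd : (n < d)%N.
  rewrite ltnNge; apply/negP => dn; have /eqP := w0 (n - d)%N.
  by rewrite natrB// wE opprB.
rewrite (_ : \prod_(0 <= j < d) _ = 0) ?mul0r ?mulr0//.
apply/eqP; rewrite prodf_seq_eq0; apply/hasP; exists (d - n.+1)%N.
  by rewrite mem_index_iota /= ltn_subrL/= (leq_ltn_trans _ nd).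
rewrite /= natrB// -natr1; apply/eqP.
have -> : w = d%:R - n%:R - 1 by rewrite -wE addrK.
by ring.
Qed.

End Coefficients.

(** * Homogeneous coordinates and Jordan blocks *)

Section Homogeneous.
Variables (R : realType) (N : nat).
Implicit Types (A : 'M[R[i]]_N.+1) (y : 'cV[R[i]]_N) (z : 'cV[R[i]]_N.+1).

Definition dehomog z : 'cV[R[i]]_N := \col_i (z (emb i) 0 / z ord_max 0).

(** The vector [(y, 1)]: [insub] fails exactly at the last index, where the default 1 is taken. *)
Definition homog y : 'cV[R[i]]_N.+1 :=
  \col_i oapp (fun j : 'I_N => y j 0) 1 (insub (i : nat)).

Lemma homog_emb y i : homog y (emb i) 0 = y i 0.
Proof. by rewrite mxE (_ : insub _ = Some i)//; exact: valK. Qed.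

Lemma homog_max y : homog y ord_max 0 = 1.
Proof. by rewrite mxE insubF//= ltnn. Qed.

Lemma mul_homog A y i : (A *m homog y) i 0 = affine_form A i y.
Proof.
rewrite mxE big_ord_recr /= homog_max mulr1; congr (_ + _).
by apply: eq_bigr => j _; rewrite -homog_emb.
Qed.

Lemma homog_dehomog z : z ord_max 0 != 0 ->
  homog (dehomog z) = (z ord_max 0)^-1 *: z.
Proof.
move=> z0; apply/colP => i; rewrite [RHS]mxE.
have [iN|iN] := ltnP i N.
  have -> : i = emb (Ordinal iN) by exact: val_inj.
  by rewrite homog_emb mxE mulrC.
have -> : i = ord_max by apply/val_inj/eqP; rewrite eqn_leq /= iN -ltnS ltn_ord.
by rewrite homog_max mulVf.
Qed.

Lemma dehomog_homog y : dehomog (homog y) = y.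
Proof. by apply/colP => i; rewrite mxE homog_emb homog_max divr1. Qed.

Lemma dehomogZ (c : R[i]) z : c != 0 -> dehomog (c *: z) = dehomog z.
Proof.
by move=> c0; apply/colP => i; rewrite !mxE -mulf_div divff// mul1r.
Qed.

(** At [dehomog z] all affine forms of [A] are the coordinates of [z'] times one nonzero scalar,
    which cancels in the quotients. *)
Lemma F1_dehomog A z z' (c : R[i]) : c != 0 -> z' = c *: (A *m z) ->
  z ord_max 0 != 0 -> z' ord_max 0 != 0 ->
  F1_defined A (dehomog z) /\ dehomog z' = F1 A (dehomog z).
Proof.
move=> c0 z'E z0 z'0.
have aE i : affine_form A i (dehomog z) = (z ord_max 0)^-1 * c^-1 * z' i 0.
  rewrite -mul_homog homog_dehomog// -scalemxAr mxE z'E [in RHS]mxE.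
  by rewrite -mulrA mulKf.
have u0 : (z ord_max 0)^-1 * c^-1 != 0 by rewrite mulf_neq0 ?invr_eq0.
split; first by rewrite /F1_defined aE mulf_neq0.
by apply/colP => i; rewrite !mxE !aE -mulf_div divff// mul1r.
Qed.

Lemma is_proj_solution_homog A (y : R[i] -> 'cV[R[i]]_N) :
  is_solution A y -> is_proj_solution A (fun w => homog (y w)).
Proof.
move=> sol; split=> w.
  by apply/eqP => /colP/(_ ord_max)/eqP; rewrite homog_max mxE oner_eq0.
have [a0 yE] := sol w; rewrite /F1_defined in a0.
exists (affine_form A ord_max (y w))^-1; first by rewrite invr_eq0.
have z0 : (A *m homog (y w)) ord_max 0 != 0 by rewrite mul_homog.
rewrite -mul_homog -homog_dehomog// yE; congr homog.
by apply/colP => i; rewrite !mxE -!mul_homog !mxE.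
Qed.

End Homogeneous.

(** * One Jordan block and its matrix of coefficients C *)

Section JordanBlock.
Variables (R : realType) (n : nat).
Implicit Types (lam w : R[i]).

Definition coef_mx lam w : 'M[R[i]]_n := \matrix_(l, m) coefC lam l m w.

(** The superdiagonal term is written as a sum over at most one index, empty in the last row, which
    avoids a case split on [l]. *)
Lemma mul_jordan_block lam p (B : 'M[R[i]]_(n, p)) (l : 'I_n) j :
  (jordan_block n lam *m B) l j =
  lam * B l j + \sum_(t < n | t == l.+1 :> nat) B t j.
Proof.
rewrite mxE [in RHS]big_mkcond /= (bigD1 l)//= [X in _ = _ + X](bigD1 l)//=.
rewrite mxE eqxx mulr1n !(gtn_eqF (ltnSn l)) (ltn_eqF (ltnSn l)) addr0 add0r.
congr (_ + _); apply: eq_bigr => t tl.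
rewrite mxE eq_sym (negbTE tl) mulr0n add0r eq_sym.
by case: eqP; rewrite ?mul1r ?mul0r.
Qed.

Lemma coef_mxD1 lam w : lam != 0 ->
  lam *: coef_mx lam (w + 1) = jordan_block n lam *m coef_mx lam w.
Proof.
move=> lam0; apply/matrixP => l m; rewrite mul_jordan_block.
transitivity (lam * coefC lam l m w + coefC lam l.+1 m w).
  by rewrite [LHS]mxE [X in _ * X]mxE; exact: coefC_pascal.
rewrite [in RHS]mxE.
congr (_ + _); have [ln|ln] := ltnP l.+1 n.
  rewrite (bigD1 (Ordinal ln))//= mxE big1 ?addr0// => t /andP[/eqP t1 /eqP[]].
  exact: val_inj.
(* In the last row the sum is empty, and [coefC] at row [n] vanishes because [m < n]. *)
rewrite coefC_gt ?(leq_trans (ltn_ord m))// big_pred0// => t.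
by rewrite ltn_eqF// (leq_trans (ltn_ord t)).
Qed.

Lemma coef_mx_unit lam w : coef_mx lam w \in unitmx.
Proof.
rewrite unitmxE -det_tr det_trig; last first.
  by apply/is_trig_mxP => l m lm; rewrite !mxE coefC_gt.
by rewrite big1 ?unitr1// => l _; rewrite !mxE coefC_diag.
Qed.

End JordanBlock.

(** * Splitting vectors along the blocks of the Jordan form *)

Section Blocks.
Variables (R : realType) (N r : nat) (k : 'I_r.+1 -> nat).
Hypothesis hk : (\sum_(i < r.+1) k i)%N = N.+1.
Implicit Types (lam : 'I_r.+1 -> R[i]) (v : 'cV[R[i]]_N.+1).

Definition block v (i : 'I_r.+1) : 'cV[R[i]]_(k i) :=
  \col_l v (cast_ord hk (tagnat.Rank i l)) 0.

Lemma block_inj v v' : (forall i, block v i = block v' i) -> v = v'.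
Proof.
move=> h; apply/colP => s.
have -> : s = cast_ord hk (tagnat.Rank _ (tagnat.sig2 (cast_ord (esym hk) s))).
  by rewrite tagnat.sig2K cast_ordKV.
have /colP/(_ (tagnat.sig2 (cast_ord (esym hk) s))) :=
  h (tagnat.sig1 (cast_ord (esym hk) s)).
by rewrite !mxE.
Qed.

Lemma block_mxcol (V : forall i, 'cV[R[i]]_(k i)) i :
  block (castmx (hk, erefl 1%N) (\mxcol_i V i)) i = V i.
Proof.
apply/colP => l; rewrite mxE castmxE /= cast_ordK cast_ord_id.
by rewrite -[in RHS](mxcolK V) [in RHS]mxE.
Qed.

Lemma mxcol_block v : castmx (hk, erefl 1%N) (\mxcol_i block v i) = v.
Proof. by apply: block_inj => i; rewrite block_mxcol. Qed.

Lemma blockZ (a : R[i]) v i : block (a *: v) i = a *: block v i.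
Proof. by apply/colP => l; rewrite !mxE. Qed.

(** The target dimension is a variable, so that the equality can be eliminated and the casts
    disappear. *)
Lemma mulmx_cast (n : nat) (e : (\sum_(i < r.+1) k i)%N = n) (B : 'M[R[i]]_(\sum_i k i))
    (v : 'cV[R[i]]_(\sum_i k i)) :
  castmx (e, e) B *m castmx (e, erefl 1%N) v = castmx (e, erefl 1%N) (B *m v).
Proof. by case: _ / e; rewrite !castmx_id. Qed.

Lemma block_jordan lam v i :
  block (jordan_mx hk lam *m v) i = jordan_block (k i) (lam i) *m block v i.
Proof.
rewrite -[in LHS](mxcol_block v) /jordan_mx mulmx_cast mul_mxdiag_mxcol.
by rewrite block_mxcol.
Qed.

Lemma block_last v (l : 'I_(k ord_max)) : l.+1 = k ord_max ->
  block v ord_max l 0 = v ord_max 0.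
Proof.
move=> lE; rewrite mxE; congr (v _ _); apply: val_inj.
transitivity (nat_of_ord (tagnat.Rank ord_max l)) => //.
rewrite tagnat.RankEsum; apply/eqP; rewrite -eqSS -addnS lE -hk.
rewrite [X in _ == X](bigD1 ord_max)//= addnC eqn_add2l; apply/eqP.
apply: eq_bigl => i; rewrite -(inj_eq val_inj) /=.
by rewrite ltn_neqAle -ltnS ltn_ord andbT.
Qed.

(** This is what allows normalizing by the last coordinate: the matrix merely multiplies it by the
    last eigenvalue. *)
Lemma jordan_mx_last lam v : (0 < k ord_max)%N ->
  (jordan_mx hk lam *m v) ord_max 0 = lam ord_max * v ord_max 0.
Proof.
move=> k0; have lk : ((k ord_max).-1 < k ord_max)%N by rewrite prednK.
have lE : (Ordinal lk).+1 = k ord_max by rewrite /= prednK.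
rewrite -!(block_last _ lE) block_jordan mul_jordan_block big_pred0 ?addr0// => t.
by rewrite lE ltn_eqF.
Qed.

(** The first basis vector of block [i] is an eigenvector for [lam i]; a zero eigenvalue would put
    it in the kernel. *)
Lemma jordan_mx_eigenvalue_neq0 lam i : (0 < k i)%N ->
  jordan_mx hk lam \in unitmx -> lam i != 0.
Proof.
move=> k0 uJ; apply/eqP => lam0.
pose V j : 'cV[R[i]]_(k j) := \col_l ((j == i) && (l == 0 :> nat))%:R.
pose v := castmx (hk, erefl 1%N) (\mxcol_j V j).
have Jv : jordan_mx hk lam *m v = 0.
  apply: block_inj => j; rewrite block_jordan block_mxcol.
  apply/colP => l; rewrite mul_jordan_block big1 ?addr0.
    rewrite !mxE; have [ji|_] := eqVneq j i; last by rewrite mulr0.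
    have -> : lam j = 0 by rewrite ji.
    by rewrite mul0r.
  by move=> t /eqP t1; rewrite mxE t1 andbF.
have v0 : v = 0 by rewrite -(mulKmx uJ v) Jv mulmx0.
have /colP/(_ (Ordinal k0))/eqP := block_mxcol V i.
by rewrite -/v v0 !mxE !eqxx eq_sym oner_eq0.
Qed.

End Blocks.

(** * The general solution: verification, completeness and dependence on w *)

Section GeneralSolution.
Variables (R : realType) (N r : nat) (k : 'I_r.+1 -> nat).
Variable hk : (\sum_(i < r.+1) k i)%N = N.+1.
Variable lam : 'I_r.+1 -> R[i].
Hypothesis k_gt0 : forall i, (0 < k i)%N.
Hypothesis lam_neq0 : forall i, lam i != 0.
Implicit Type I : coef_family R k.

(** A fundamental matrix of the normalized linear system of block [i]. *)
Definition fundamental_mx i w : 'M[R[i]]_(k i) :=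
  cpow (lam i / lam ord_max) w *: coef_mx (k i) (lam i) w.

Lemma fundamental_mx_unit i w : fundamental_mx i w \in unitmx.
Proof. by rewrite unitmxZ ?unitfE ?cpow_neq0// coef_mx_unit. Qed.

Lemma fundamental_mxD1 i w :
  fundamental_mx i (w + 1) =
  (lam ord_max)^-1 *: (jordan_block (k i) (lam i) *m fundamental_mx i w).
Proof.
rewrite /fundamental_mx cpowD1 ?mulf_neq0 ?invr_eq0//.
rewrite -scalemxAr -coef_mxD1// !scalerA; congr (_ *: _).
by field; rewrite lam_neq0.
Qed.

Definition coef_col I i w : 'cV[R[i]]_(k i) := \col_m I i m w.

Lemma coef_colE I i m w : coef_col I i w m 0 = I i m w.
Proof. by rewrite mxE. Qed.

Lemma Yblock_fundamental I i w :
  \col_l Yblock lam I l w = fundamental_mx i w *m coef_col I i w.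
Proof.
apply/colP => l; rewrite -scalemxAl !mxE; congr (_ * _).
by apply: eq_bigr => m _; rewrite !mxE.
Qed.

Lemma block_Yvec I i w :
  block hk (Yvec hk lam I w) i = fundamental_mx i w *m coef_col I i w.
Proof. by rewrite /Yvec block_mxcol Yblock_fundamental. Qed.

(** The power is [1 ^ w = 1], and the last row of a triangular matrix keeps only its diagonal
    entry. *)
Lemma Yblock_last I w (l : 'I_(k ord_max)) : l.+1 = k ord_max ->
  Yblock lam I l w = I ord_max l w.
Proof.
move=> lE; rewrite /Yblock divff// cpow1 mul1r (bigD1 l)//= coefC_diag mul1r.
rewrite big1 ?addr0// => m ml; rewrite coefC_gt ?mul0r//.
by rewrite ltn_neqAle -(inj_eq val_inj) in ml *; rewrite ml -ltnS lE ltn_ord.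
Qed.

Lemma Yvec_last I w : admissible I -> Yvec hk lam I w ord_max 0 = 1.
Proof.
move=> [_ Ilast]; have lk : ((k ord_max).-1 < k ord_max)%N by rewrite prednK.
have lE : (Ordinal lk).+1 = k ord_max by rewrite /= prednK.
rewrite -(block_last hk _ lE) /Yvec block_mxcol mxE Yblock_last//.
exact: Ilast.
Qed.

Lemma YvecD1 I w : admissible I ->
  Yvec hk lam I (w + 1) =
  (lam ord_max)^-1 *: (jordan_mx hk lam *m Yvec hk lam I w).
Proof.
move=> [Iper _]; apply: (block_inj (hk := hk)) => i.
rewrite blockZ block_jordan !block_Yvec fundamental_mxD1 -scalemxAl -mulmxA.
by congr (_ *: (_ *m (_ *m _))); apply/colP => m; rewrite !mxE Iper.
Qed.

Variables A U : 'M[R[i]]_N.+1.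
Hypothesis uU : U \in unitmx.
Hypothesis UAU : U *m A *m invmx U = jordan_mx hk lam.

Definition zgen I w : 'cV[R[i]]_N.+1 := invmx U *m Yvec hk lam I w.

Lemma ysumE I i w : ysum hk lam I U i w = zgen I w i 0.
Proof. by rewrite mxE. Qed.

Lemma ygenE I w : ygen hk lam I U w = dehomog (zgen I w).
Proof. by apply/colP => i; rewrite [LHS]mxE !ysumE [RHS]mxE. Qed.

Lemma conj_jordan (v : 'cV[R[i]]_N.+1) : U *m (A *m v) = jordan_mx hk lam *m (U *m v).
Proof. by rewrite -UAU [in RHS]mulmxA mulmxKV// mulmxA. Qed.

Lemma zgenD1 I w : admissible I ->
  zgen I (w + 1) = (lam ord_max)^-1 *: (A *m zgen I w).
Proof.
move=> adI; rewrite /zgen YvecD1// -scalemxAr; congr (_ *: _).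
by apply: (canLR (mulKmx uU)); rewrite conj_jordan mulKVmx.
Qed.

(** Applying [U] gives back [Yvec], whose last coordinate is 1. *)
Lemma zgen_neq0 I w : admissible I -> zgen I w != 0.
Proof.
move=> adI; apply/eqP => z0; have := Yvec_last w adI.
rewrite -[Yvec _ _ _ _](mulKVmx uU) -/(zgen I w) z0 mulmx0 mxE => /esym/eqP.
by rewrite oner_eq0.
Qed.

Lemma zgen_is_proj_solution I : admissible I -> is_proj_solution A (zgen I).
Proof.
move=> adI; split=> w; first exact: zgen_neq0.
by exists (lam ord_max)^-1; [rewrite invr_eq0|exact: zgenD1].
Qed.

(** Completeness: [U *m z w] divided by its last coordinate [p w] obeys the normalized linear
    system, so the inverse fundamental matrices extract periodic coefficients from it. *)
Lemma proj_solution_zgen z : is_proj_solution A z ->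
  exists I, admissible I /\ forall w, (U *m z w) ord_max 0 != 0 ->
    zgen I w = ((U *m z w) ord_max 0)^-1 *: z w.
Proof.
move=> [z0 zD1]; pose p w := (U *m z w) ord_max 0.
pose Y w := (p w)^-1 *: (U *m z w).
(* The value 1 where [p] vanishes keeps the last function identically 1; it does not break
   periodicity, since the zero set of [p] is invariant under [w -> w + 1]. *)
pose I : coef_family R k := fun i m w =>
  if p w == 0 then 1 else (invmx (fundamental_mx i w) *m block hk (Y w) i) m 0.
have IE i w : p w != 0 ->
    coef_col I i w = invmx (fundamental_mx i w) *m block hk (Y w) i.
  by move=> pw; apply/colP => m; rewrite [LHS]mxE /I (negbTE pw).
have YE w : p w != 0 -> Yvec hk lam I w = Y w.
  move=> pw; apply: (block_inj (hk := hk)) => i.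
  by rewrite block_Yvec IE// mulKVmx// fundamental_mx_unit.
have pD1 w : exists2 c, c != 0 &
    U *m z (w + 1) = c *: (jordan_mx hk lam *m (U *m z w)) /\
    p (w + 1) = c * (lam ord_max * p w).
  have [c c0 zE] := zD1 w; exists c => //.
  have e : U *m z (w + 1) = c *: (jordan_mx hk lam *m (U *m z w)).
    by rewrite zE -scalemxAr conj_jordan.
  by split=> //; rewrite /p e mxE jordan_mx_last.
have p0 w : (p (w + 1) == 0) = (p w == 0).
  have [c c0 [_ ->]] := pD1 w.
  by rewrite !mulf_eq0 (negbTE c0) (negbTE (lam_neq0 _)).
(* The unknown projective factor [c] cancels in the normalization. *)
have YD1 w : p w != 0 -> Y (w + 1) = (lam ord_max)^-1 *: (jordan_mx hk lam *m Y w).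
  move=> pw; have [c c0 [e pE]] := pD1 w.
  rewrite /Y e pE -scalemxAr !scalerA; congr (_ *: _).
  by field; rewrite c0 pw lam_neq0.
exists I; split; last first.
  by move=> w pw; rewrite /zgen YE// -scalemxAr mulKmx.
split=> [i m w|m mE w].
  have [pw|pw] := eqVneq (p w) 0.
    by rewrite /I pw eqxx p0 pw eqxx.
  (* The block of [Y] and the fundamental matrix are advanced by the same matrix, so their quotient
     is unchanged. *)
  have colD1 : coef_col I i (w + 1) = coef_col I i w.
    rewrite IE ?p0// YD1// blockZ block_jordan.
    rewrite -(YE w pw) block_Yvec mulmxA scalemxAl -fundamental_mxD1.
    by rewrite mulKmx// fundamental_mx_unit.
  by rewrite -[LHS]coef_colE colD1 coef_colE.
have [pw|pw] := eqVneq (p w) 0; first by rewrite /I pw eqxx.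
(* The last function equals the last coordinate of [Y], which is [p w / p w]. *)
rewrite -(Yblock_last I w mE).
have /colP/(_ m) := Yblock_fundamental I ord_max w.
rewrite mxE => ->; rewrite -block_Yvec YE// block_last//.
by rewrite mxE -/(p w) mulVf.
Qed.

(** The polynomials combine entries of [invmx U] with [coef_poly]; they are chosen before [I], so
    they depend on [U] and [lam] only. *)
Lemma ysum_polynomial :
  exists a : 'I_N.+1 -> forall i : 'I_r.+1, 'I_(k i) -> {poly R[i]},
    forall I w j, ysum hk lam I U j w =
      \sum_(i < r.+1) \sum_(m < k i)
        cpow (lam i / lam ord_max) w * (a j i m).[w] * I i m w.
Proof.
pose V := castmx (erefl N.+1, esym hk) (invmx U).
exists (fun j i m => \sum_(l < k i) submxrow V i j l *: coef_poly (lam i) l m).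
move=> I w j; rewrite ysumE.
have -> : zgen I w = V *m \mxcol_i (\col_l Yblock lam I l w).
  (* After generalization, eliminating [hk] moves the cast from the column to the matrix. *)
  rewrite /zgen /Yvec /V; move: (\mxcol_i _) (invmx U).
  by case: _ / hk => v B; rewrite !castmx_id.
rewrite -[V]submxrowK mul_mxrow_mxcol summxE; apply: eq_bigr => i _.
rewrite mxE; under [RHS]eq_bigr do rewrite horner_sum mulr_sumr mulr_suml.
rewrite [RHS]exchange_big /=; apply: eq_bigr => l _.
rewrite submxrowK [X in _ * X = _]mxE /Yblock mulrCA mulr_sumr mulr_sumr.
apply: eq_bigr => m _; rewrite coefCE hornerZ.
by rewrite -!mulrA; congr (_ * _); rewrite mulrA.
Qed.

End GeneralSolution.

Theorem theorem1 (R : realType) (N r : nat) (k : 'I_r.+1 -> nat)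
    (lam : 'I_r.+1 -> R[i]) (A U : 'M[R[i]]_N.+1)
    (hk0 : forall i, (0 < k i)%N)
    (hk : (\sum_(i < r.+1) k i)%N = N.+1)
    (hA : \det A != 0)
    (hU : U \in unitmx)
    (hD : U *m A *m invmx U = jordan_mx hk lam) :
  (* every choice of the periodic functions gives a solution *)
  (forall I : coef_family R k, admissible I ->
     (forall w, ysum hk lam I U ord_max w != 0 ->
        ysum hk lam I U ord_max (w + 1) != 0 ->
        F1_defined A (ygen hk lam I U w) /\
        ygen hk lam I U (w + 1) = F1 A (ygen hk lam I U w)) /\
     is_proj_solution A (fun w => \col_(i < N.+1) ysum hk lam I U i w)) /\
  (* every solution without poles is of this form, wherever the last component
     of U (y, 1) does not vanish *)
  (forall y : R[i] -> 'cV[R[i]]_N, is_solution A y ->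
     exists I : coef_family R k, admissible I /\
       forall w, affine_form U ord_max (y w) != 0 ->
         ysum hk lam I U ord_max w != 0 /\ y w = ygen hk lam I U w) /\
  (* the same for solutions with poles *)
  (forall z : R[i] -> 'cV[R[i]]_N.+1, is_proj_solution A z ->
     exists I : coef_family R k, admissible I /\
       forall w, (U *m z w) ord_max 0 != 0 ->
         (z w ord_max 0 != 0 <-> ysum hk lam I U ord_max w != 0) /\
         (z w ord_max 0 != 0 ->
            forall i : 'I_N,
              z w (emb i) 0 / z w ord_max 0 = ygen hk lam I U w i 0)) /\
  (* polynomial dependence on w (and on the powers (lam_i / lam_r)^w) of the
     coefficients of a linear-fractional expression in the functions I *)
  (exists a : 'I_N.+1 -> forall i : 'I_r.+1, 'I_(k i) -> {poly R[i]},
     forall (I : coef_family R k) (w : R[i]) (j : 'I_N.+1),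
       ysum hk lam I U j w =
         \sum_(i < r.+1) \sum_(m < k i)
           cpow (lam i / lam ord_max) w * (a j i m).[w] * I i m w) /\
  (* the coefficients C *)
  (forall (i : 'I_r.+1) (l m : 'I_(k i)) (w : R[i]),
     ((m < l)%N -> coefC (lam i) l m w = 0) /\
     coefC (lam i) m m w = 1 /\
     ((l <= m)%N -> (forall n : nat, w + 1 != - n%:R) ->
        coefC (lam i) l m w =
          Gamma (w + 1) * lam i ^- (m - l)
          / (Gamma (w + 1 - m%:R + l%:R) * Gamma ((m - l)%:R + 1)))) /\
  (* the last component of Y *)
  (forall I : coef_family R k, admissible I ->
     forall (l : 'I_(k ord_max)), l.+1 = k ord_max ->
     forall w, Yblock lam I l w = 1).
Proof.
(* Invertibility of [A] passes to its Jordan form and makes every eigenvalue nonzero. *)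
have hJ : jordan_mx hk lam \in unitmx.
  by rewrite -hD !unitmx_mul unitmx_inv hU unitmxE unitfE hA.
have lam0 i : lam i != 0 by exact: jordan_mx_eigenvalue_neq0 (hk0 i) hJ.
have colE I : (fun w => \col_(i < N.+1) ysum hk lam I U i w) = zgen hk lam U I.
  by apply/funext => w; apply/colP => i; rewrite mxE ysumE.
(* Common source of both converse statements; a solution without poles enters through its lift
   [(y, 1)]. *)
have proj z : is_proj_solution A z ->
    exists I : coef_family R k, admissible I /\
      forall w, (U *m z w) ord_max 0 != 0 ->
        (z w ord_max 0 != 0 <-> ysum hk lam I U ord_max w != 0) /\
        ygen hk lam I U w = dehomog (z w).
  move=> /(proj_solution_zgen hk0 lam0 hU hD)[I [adI zI]].
  exists I; split=> // w p0; rewrite ysumE ygenE zI//; split.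
    by rewrite mxE mulf_eq0 invr_eq0 (negbTE p0).
  by rewrite dehomogZ// invr_eq0.
split; [|split; [|split; [|split; [|split]]]].
- move=> I adI; split; last by rewrite colE; exact: zgen_is_proj_solution.
  move=> w; rewrite !ysumE !ygenE => z0 z1.
  by apply: F1_dehomog z0 z1; [|exact: zgenD1]; rewrite invr_eq0.
- move=> y /is_proj_solution_homog/proj[I [adI zI]].
  exists I; split=> // w; rewrite -mul_homog => /zI[zy ->].
  by rewrite -zy homog_max oner_neq0 dehomog_homog.
- move=> z /proj[I [adI zI]]; exists I; split=> // w /zI[zy ->].
  by split=> // _ i; rewrite mxE.
- exact: ysum_polynomial.
- move=> i l m w; split; [|split].
  + exact: coefC_gt.
  + exact: coefC_diag.
  + exact: coefC_Gamma.
- by move=> I adI l lE w; rewrite Yblock_last//; exact: adI.2.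
Qed.
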